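(* Let $U$ be an infinite set such that $|U| = \kappa$, $\aleph_0 \leq \kappa$. Then, for every $S \subseteq U$ such that $|S| < |U|$, there exists an injective function $\star_S : U^2 \to U$ such that $\mathit{fix}_\pi(\star_S) = S$.
   Context: For $\star : U^2 \to U$, the $\pi$-controlled fixpoints of $\star$ are $\mathit{fix}_\pi(\star) = \{u \in U \mid (\exists v \in U)(u \star v = u)\}$. *)

(* Defs.v *)
From mathcomp Require Import all_boot.
From mathcomp Require Import boolp classical_sets functions cardinality.

Set Implicit Arguments.
Unset Strict Implicit.
Unset Printing Implicit Defensive.

Local Open Scope classical_set_scope.
Local Open Scope card_scope.

(* Strict comparison of cardinals, [|A| < |B|]; the library only provides
   [#<=] and [#=]. *)
Definition card_lt (T U : Type) (A : set T) (B : set U) : Prop :=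
  A #<= B /\ A #!= B.

(* The pi-controlled fixpoints of a binary operation.  The operation is
   uncurried, so that [injective star] means injectivity on pairs. *)
Definition fix_pi (U : Type) (star : U * U -> U) : set U :=
  [set u | exists v : U, star (u, v) = u].

(* Main.v *)
Require Import Defs.
From mathcomp Require Import all_boot.
From mathcomp Require Import boolp classical_sets functions cardinality.

(** The set U has as many elements as U `*` U `*` U, and as many as the complement
    of S, so there is an injection h of U `*` U `*` U into the complement of S.
    Fix a <> b. Since h (u, v, a) and h (u, v, b) differ, one of them is not u;
    choosing it as g (u, v) gives an injection g with values outside S and without
    controlled fixpoints. Replacing g (s, s) by s for s in S gives the operation.
    The equality |U `*` U| = |U| is obtained by Zorn's lemma applied to the
    injections of D `*` D into D for infinite subsets D of U: if D is maximal and
    smaller than U, then U contains a copy of D disjoint from D, and the injection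
    extends to the union of both. *)

Set Implicit Arguments.
Unset Strict Implicit.
Unset Printing Implicit Defensive.

Local Open Scope classical_set_scope.
Local Open Scope card_scope.

Lemma card_le_injfun (T : Type) (U : pointedType) (A : set T) (B : set U) :
  A #<= B <-> exists2 f : T -> U, set_fun A B f & set_inj A f.
Proof. by rewrite -injfunPex; split=> [/pcard_leP|?]; last exact/pcard_leP. Qed.

(** Choice extracts a function from [R], and the second condition makes it injective. [R] may relate
    [x] to several [y], so injections can be glued without deciding overlaps. *)
Lemma rel_card_le (T U : Type) (A : set T) (B : set U) (R : T -> U -> Prop) :
    (forall x, A x -> exists2 y, B y & R x y) ->
    (forall x x' y, R x y -> R x' y -> x = x') ->
  A #<= B.
Proof.
(* [card_le_injfun] needs a pointed codomain; if [U] is empty, so is [A]. *)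
elim/Ppointed: U => U in B R *.
  move=> AR _; suff -> : A = set0 by [].
  by rewrite -subset0 => x /AR[y]; rewrite emptyE.
move=> AR Rinj.
have /choice[f fP] x : exists y, A x -> B y /\ R x y.
  have [/AR[y By Rxy]|nAx] := pselect (A x); first by exists y.
  by exists point.
apply/card_le_injfun; exists f => [x /fP[]//|x y].
by rewrite !inE => /fP[_ Rx] /fP[_ Ry] fxy; rewrite fxy in Rx; apply: Rinj Rx Ry.
Qed.

Lemma card_le_setX (T T' U U' : Type) (A : set T) (A' : set T')
    (B : set U) (B' : set U') :
  A #<= B -> A' #<= B' -> A `*` A' #<= B `*` B'.
Proof.
elim/Ppointed: U => U in B *.
  by rewrite [B]emptyE => /card_le0P -> _; rewrite set0X.
elim/Ppointed: U' => U' in B' *.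
  by rewrite [B']emptyE => _ /card_le0P ->; rewrite setX0.
move=> /card_le_injfun[f fAB fI] /card_le_injfun[g gAB gI].
apply/card_le_injfun; exists (fun x => (f x.1, g x.2)) => [x [/fAB ? /gAB ?]//|].
move=> [x x'] [y y'] /set_mem[/= Ax Ax'] /set_mem[/= Ay Ay'] [fxy gxy].
by congr (_, _); [apply: fI|apply: gI] => //; apply/mem_set.
Qed.

(** By Zorn's lemma there is a maximal partial bijection [G] between [A] and [B]. Its domain is [A]
    or its range is [B], since otherwise a pair of missing elements could be added. *)
Lemma card_le_total (T U : Type) (A : set T) (B : set U) :
  A #<= B \/ B #<= A.
Proof.
pose P (G : set (T * U)) := G `<=` A `*` B /\
  (forall p q, G p -> G q -> p.1 = q.1 <-> p.2 = q.2).
have [F FP Ftot|G [[GAB Ginj] Gmax]] := @Zorn_bigcup _ P.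
  split=> [p [X /FP[XAB _]]|p q [X FX Xp] [Y FY Yq]]; first exact: XAB.
  have [XY|YX] := Ftot X Y FX FY.
    by apply: (FP Y FY).2 => //; apply: XY.
  by apply: (FP X FX).2 => //; apply: YX.
have [domG|/existsNP[a /not_implyP[Aa nGa]]] :=
    pselect (forall x, A x -> exists y, G (x, y)).
  left; apply: (@rel_card_le _ _ _ _ (fun x y => G (x, y))).
    by move=> x /domG[y Gxy]; exists y => //; case: (GAB _ Gxy).
  by move=> x x' y Gx Gx'; apply/(Ginj _ _ Gx Gx').
have [ranG|/existsNP[b /not_implyP[Bb nGb]]] :=
    pselect (forall y, B y -> exists x, G (x, y)).
  right; apply: (@rel_card_le _ _ _ _ (fun y x => G (x, y))).
    by move=> y /ranG[x Gxy]; exists x => //; case: (GAB _ Gxy).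
  by move=> y y' x Gy Gy'; apply/(Ginj _ _ Gy Gy').
exfalso; apply: (Gmax (G `|` [set (a, b)])).
  split; first by move=> p; left.
  by move=> /(_ (a, b)) Gab; apply: nGa; exists b; apply: Gab; right.
split=> [p [/GAB//|->//]|[x y] [x' y'] /=].
move=> [Gxy|[-> ->]] [Gxy'|[-> ->]] //.
- exact: (Ginj _ _ Gxy Gxy').
- by split=> e; [case: nGa; exists y | case: nGb; exists x]; rewrite -e.
- by split=> e; [case: nGa; exists y' | case: nGb; exists x']; rewrite e.
Qed.

Lemma infinite_set_neq (T : Type) (A : set T) :
  infinite_set A -> exists x y, [/\ A x, A y & x <> y].
Proof.
move=> Ainf; have [x Ax] := infinite_setN0 Ainf.
have [y [Ay /= yx]] := infinite_setN0 (infinite_setD Ainf (finite_set1 x)).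
by exists x, y; split=> // xy; apply: yx.
Qed.

(** Two distinct elements [a], [b] of [D] serve as tags: [X] is sent into the pairs starting with
    [a], [Y] into those starting with [b]. *)
Lemma card_le_setU (T U : Type) (X Y : set T) (D : set U) :
    infinite_set D -> D `*` D #<= D -> X #<= D -> Y #<= D ->
  X `|` Y #<= D.
Proof.
move=> Dinf DD; have [a [b [Da Db ab]]] := infinite_set_neq Dinf.
elim/Ppointed: U => U in D Dinf DD a b Da Db ab *; first by rewrite emptyE in Da.
move=> /card_le_injfun[f fXD fI] /card_le_injfun[g gYD gI].
apply: card_le_trans DD.
apply: (@rel_card_le _ _ _ _ (fun x p =>
  (X x /\ p = (a, f x)) \/ (Y x /\ p = (b, g x)))).
  move=> x [Xx|Yx]; first by exists (a, f x); [split=> //; apply: fXD|left].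
  by exists (b, g x); [split=> //; apply: gYD|right].
move=> x x' p [[Xx ->]|[Yx ->]] [[Xx' e]|[Yx' e]]; case: e => // e.
- by apply: fI => //; apply/mem_set.
- by case: (ab (esym e)).
- by apply: gI => //; apply/mem_set.
Qed.

Lemma card_setX_self (T : Type) (A : set T) :
  infinite_set A -> A `*` A #<= A.
Proof.
move=> Ainf; pose dom (G : set (T * T * T)) := [set x | exists z, G (x, x, z)].
(* [P G]: G is an injective relation from D `*` D to D for an infinite D included
   in A, where D is recovered from the diagonal of G. *)
pose P G := [/\ dom G `<=` A,
  forall x y z, G (x, y, z) ->
    [/\ dom G x, dom G y, dom G z & infinite_set (dom G)],
  forall x y, dom G x -> dom G y -> exists z, G (x, y, z) &
  forall p q z, G (p, z) -> G (q, z) -> p = q].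
have domS G G' : G `<=` G' -> dom G `<=` dom G' by move=> s x [z /s]; exists z.
elim/Ppointed: T => T in A Ainf dom P domS *.
  by move: Ainf; rewrite emptyE => /(_ (finite_set0 _)).
(* [G = set0] also satisfies [P], so that the empty chain is bounded; a maximal G
   is nonempty because A contains a countable D. *)
have [F FP Ftot|G [[GA Gcl Gtot Ginj] Gmax]] := @Zorn_bigcup _ P.
  have FU X : F X -> X `<=` \bigcup_(X in F) X by move=> FX x Xx; exists X.
  split.
  - by move=> x [z [X FX Xz]]; have [+ _ _ _] := FP X FX; apply; exists z.
  - move=> x y z [X FX Xxyz].
    have [_ /(_ _ _ _ Xxyz)[dx dy dz dinf] _ _] := FP X FX.
    have XU := domS _ _ (FU X FX).
    by split; [exact: XU|exact: XU|exact: XU|exact: sub_infinite_set dinf].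
  (* The larger of the two members of the chain has both [x] and [y] in its domain. *)
  - move=> x y [z [X FX Xz]] [w [Y FY Yw]].
    have [XY|YX] := Ftot X Y FX FY.
      have [_ _ /(_ x y) Yt _] := FP Y FY.
      have [||u Yu] := Yt; [by exists z; apply: XY|by exists w|].
      by exists u, Y.
    have [_ _ /(_ x y) Xt _] := FP X FX.
    have [||u Xu] := Xt; [by exists z|by exists w; apply: YX|].
    by exists u, X.
  - move=> p q z [X FX Xp] [Y FY Yq].
    have [XY|YX] := Ftot X Y FX FY.
      by have [_ _ _] := FP Y FY; apply; [apply: XY; exact: Xp|].
    by have [_ _ _] := FP X FX; apply; [exact: Xp|apply: YX].
have Dinf : infinite_set (dom G).
  have /infiniteP/card_le_injfun[f fA fI] := Ainf.
  have {}fI m n : f m = f n -> m = n by apply: fI; rewrite inE.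
  have /card_le_injfun[k _ kI] : [set: nat * nat] #<= [set: nat].
    by rewrite (card_le_eql card_nat2).
  have {}kI m n : k m = k n -> m = n by apply: kI; rewrite inE.
  (* The pairing [k] of natural numbers, transported along [f]. *)
  pose G0 : set (T * T * T) :=
    [set p | exists m n, p = (f m, f n, f (k (m, n)))].
  have dG0 : dom G0 = range f.
    apply/seteqP; split=> [x [z [m [n [-> _ _]]]]|x [m _ <-]]; first by exists m.
    by exists (f (k (m, m))), m, m.
  have [G00|] := pselect (G = set0); last first.
    by move=> /eqP/set0P[[[x y] z]] /Gcl[].
  exfalso; apply: (Gmax G0).
    by rewrite G00; split=> // /(_ (f 0, f 0, f (k (0, 0)))) []; exists 0, 0.
  split; rewrite ?dG0.
  - by move=> _ [n _ <-]; apply: fA.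
  - move=> x y z [m [n [-> -> ->]]].
    split; [by exists m|by exists n|by exists (k (m, n))|].
    apply/infiniteP/card_le_injfun; exists f => [n' _|m' n' _ _ /fI//].
    by exists n'.
  - by move=> _ _ [m _ <-] [n _ <-]; exists (f (k (m, n))), m, n.
  - by move=> p q z [m [n [-> ->]]] [m' [n' [-> /fI/kI[-> ->]]]].
have DD : dom G `*` dom G #<= dom G.
  apply: (@rel_card_le _ _ _ _ (fun p z => G (p, z))) => // -[x y] [/= Dx Dy].
  by have [z Gz] := Gtot x y Dx Dy; exists z => //; case: (Gcl _ _ _ Gz).
(* If the rest of [A] is no larger than [dom G], then [A] itself embeds into [dom G], and [DD]
   carries over to [A]. *)
have [AD|] := card_le_total (A `\` dom G) (dom G).
  have {}AD : A #<= dom G.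
    rewrite -(setDUK GA) setUC.
    by apply: card_le_setU => //; apply: card_lexx.
  apply: card_le_trans (card_le_setX AD AD) _.
  by apply: card_le_trans DD _; apply: subset_card_le.
(* Otherwise [e] copies [dom G] into the rest of [A], which leaves room to enlarge [G]. *)
move=> /card_le_injfun[e eA eI]; exfalso.
set D := dom G in GA Gcl Gtot Dinf DD e eA eI *.
pose D' := D `|` e @` D.
have D'D : D' `*` D' #<= D.
  apply: (card_le_trans _ DD); suff D'D : D' #<= D by apply: card_le_setX.
  by apply: card_le_setU => //; exact: card_image_le.
have /card_le_injfun[h hD hI] := D'D.
(* The pairs of D' outside D `*` D are sent into the fresh copy [e @` D] of D, so
   that they cannot collide with values of G. *)
pose G' := G `|`
  [set p | [/\ D' p.1.1, D' p.1.2, ~ (D `*` D) p.1 & p.2 = e (h p.1)]].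
have Ge p w : D w -> ~ G (p, e w).
  by case: p => x y Dw /Gcl[_ _ Dew _]; have [] := eA _ Dw.
have ehD p : D' p.1 -> D' p.2 -> D (h p) by move=> ? ?; apply: hD.
have dG' : dom G' = D'.
  apply/seteqP; split=> [x [z [Gz|[]//]]|x D'x]; first by left; exists z.
  have [[z Gz]|nDx] := pselect (D x); first by exists z; left.
  by exists (e (h (x, x))); right; split=> //= -[].
have D'inf : infinite_set D' by apply: sub_infinite_set Dinf => x; left.
apply: (Gmax G').
  split; first by move=> p; left.
  (* The extension is proper: its triple above [(e d, e d)] has its value outside [D], hence is not
     in [G]. *)
  have [d Dd] := infinite_setN0 Dinf.
  have D'd : D' (e d) by right; exists d.
  move=> /(_ (e d, e d, e (h (e d, e d)))) G'G.
  apply: (Ge (e d, e d) (h (e d, e d))).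
    exact: ehD.
  by apply: G'G; right; split=> //= -[/=]; have [] := eA _ Dd.
split; rewrite ?dG'.
- by move=> x [/GA//|[d /eA[Aed _] <-]].
- move=> x y z [/Gcl[Dx Dy Dz _]|[/= D'x D'y _ ->]]; first by split=> //; left.
  by split=> //; right; exists (h (x, y)) => //; apply: ehD.
- move=> x y D'x D'y; have [[Dx Dy]|nD] := pselect ((D `*` D) (x, y)).
    by have [z Gz] := Gtot x y Dx Dy; exists z; left.
  by exists (e (h (x, y))); right.
- move=> p q z [Gp|[/= Dp1 Dp2 _ ->]] [Gq|[/= Dq1 Dq2 _ ez]].
  + exact: Ginj Gp Gq.
  + by case: (Ge p (h q)); [exact: ehD|rewrite -ez].
  + by case: (Ge q (h p)); [exact: ehD|].
  + by apply: hI; rewrite ?inE //; apply: eI; rewrite ?inE //; apply: ehD.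
Qed.

(** [U] is the union of [S] and its complement, so it embeds into the larger of the two; this cannot
    be [S], which is strictly smaller than [U]. *)
Lemma card_setC_ge (U : Type) (S : set U) :
  infinite_set [set: U] -> card_lt S [set: U] -> [set: U] #<= ~` S.
Proof.
move=> Uinf [_ SU].
have unionT (X : set U) : ~` X #<= X -> [set: U] #<= X.
  move=> XcX; rewrite -(setUv X).
  have Xinf : infinite_set X.
    move=> Xfin; apply: Uinf; rewrite -(setUv X) finite_setU; split=> //.
    exact: card_le_finite XcX Xfin.
  by apply: card_le_setU => //; exact: card_setX_self.
have [/unionT TS|ScS] := card_le_total (~` S) S.
  by case/negP: SU; rewrite card_eq_le TS card_leT.
by apply: unionT; rewrite setCK.
Qed.

Theorem proposition16 (U : Type) (hU : infinite_set [set: U])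
    (S : set U) (hS : card_lt S [set: U]) :
  exists star : U * U -> U, injective star /\ fix_pi star = S.
Proof.
have UC := card_setC_ge hU hS.
have [a [b [_ _ ab]]] := infinite_set_neq hU.
elim/Ppointed: U => U in hU S hS UC a b ab *; first by case: hU; rewrite emptyE.
have UU : [set: U] `*` [set: U] #<= [set: U] by apply: card_setX_self.
have /card_le_injfun[h hC hI] : [set: U] `*` [set: U] `*` [set: U] #<= ~` S.
  apply: card_le_trans UC; apply: (card_le_trans _ UU).
  exact: card_le_setX.
have {}hC p : ~ S (h p) by apply: hC.
have {}hI p q : h p = h q -> p = q by apply: hI; rewrite inE.
pose g p := h (p, if `[< h (p, a) = p.1 >] then b else a).
have gI p q : g p = g q -> p = q by move=> /hI[].
have gN p : g p <> p.1.
  (* If [h (p, a)] and [h (p, b)] were both [p.1], injectivity of [h] would give [a = b]. *)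
  rewrite /g; case: asboolP => // <- /hI[/esym]; exact: ab.
pose star p := if `[< S p.1 /\ p.1 = p.2 >] then p.1 else g p.
exists star; split=> [p q|].
  (* In the mixed cases one value lies in [S] and the other, being a value of [h], does not. *)
  rewrite /star; case: asboolP => [[Sp ep]|_]; case: asboolP => [[Sq eq]|_].
  - by move: p q ep eq {Sp Sq} => [p1 p2] [q1 q2] /= <- <- ->.
  - by move=> e; rewrite e in Sp; case: (hC _ Sp).
  - by move=> e; rewrite -e in Sq; case: (hC _ Sq).
  - exact: gI.
apply/seteqP; split=> [u [v]|u Su].
  by rewrite /star; case: asboolP => [[]//|_ /gN].
by exists u; rewrite /star; case: asboolP => // -[].
Qed.
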